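(* For every integer $n\ge 0$, the following identities hold. (i) $$Q_n(t,q)=\sum_{\sigma\in \mathcal{S}_n^{0}} t^{\mathrm{cs}(\sigma)}q^{(2\text{-}31)(|\sigma|)+\mathrm{pat}_Q(\sigma)}.$$ (ii) $$R_n(t,q)=\sum_{\sigma\in \mathcal{S}^{00}_{n+1}} t^{\mathrm{cs}(\sigma)}q^{(2\text{-}31)(|\sigma|)+\mathrm{pat}_R(\sigma)-n-1}.$$
   Context: Polynomials. Let $D$ be the $q$-derivative on polynomials in $t$, $(Df)(t)=\frac{f(qt)-f(t)}{(q-1)t}$ (so $D(t^m)=[m]_q t^{m-1}$, $[m]_q=1+q+\cdots+q^{m-1}$, $[0]_q=0$), and $U$ multiplication by $t$. Then $Q_n(t,q)=(D+UDU)^n\,1$ and $R_n(t,q)=(D+DUU)^n\,1$ (products are compositions). Snakes. A signed permutation of $\{1,\dots,N\}$ is a bijection $\sigma$ of $\{\pm1,\dots,\pm N\}$ with $\sigma(-i)=-\sigma(i)$, written $\sigma=\sigma_1\cdots\sigma_N$, $\sigma_i=\sigma(i)$. It is a snake of size $N$ if $\sigma_1>\sigma_2<\sigma_3>\cdots\sigma_N$ (alternating, starting with a descent). $\mathcal{S}^0_N$ is the set of snakes of size $N$ with $\sigma_1>0$; $\mathcal{S}^{00}_N$ is the set of those with $\sigma_1>0$ and $(-1)^N\sigma_N<0$. (For $N=0$, $\mathcal{S}^0_0$ consists of the empty permutation.) Conventions: $\sigma_0=0$ and $\sigma_{N+1}=(-1)^N(N+1)$ if $\sigma$ is regarded as an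 element of $\mathcal{S}^0_N$; $\sigma_0=\sigma_{N+1}=0$ if it is regarded as an element of $\mathcal{S}^{00}_N$. With these conventions, $\mathrm{cs}(\sigma)=\#\{i:0\le i\le N,\ \sigma_i\sigma_{i+1}<0\}$, and $|\sigma|$ is the sequence with $|\sigma|_i=|\sigma_i|$ for $0\le i\le N+1$. Patterns. Let $\pi=|\sigma|$. For an element $k\in\{1,\dots,N\}$, say $k=\pi_i$ with $1\le i\le N$, let $(13\text{-}2)(\pi,k)=\#\{j:0\le j<i-1,\ \pi_j<k<\pi_{j+1}\}$, $\ (2\text{-}31)(\pi,k)=\#\{j:i<j\le N,\ \pi_j>k>\pi_{j+1}\}$, and $(2\text{-}31)(\pi)=\sum_{k=1}^N(2\text{-}31)(\pi,k)$. Classes of elements (with $1\le i\le N$): $X(\sigma)=\{|\sigma|_i: |\sigma|_{i-1}>|\sigma|_i<|\sigma|_{i+1},\ \sigma_{i-1}\sigma_i<0,\ \sigma_i\sigma_{i+1}<0\}$; $Y(\sigma)=\{|\sigma|_i: |\sigma|_{i-1}<|\sigma|_i<|\sigma|_{i+1}\text{ or }|\sigma|_{i-1}>|\sigma|_i>|\sigma|_{i+1}\}$; $Z(\sigma)=\{|\sigma|_i: |\sigma|_{i-1}<|\sigma|_i>|\sigma|_{i+1}\}$. Statistics. For $\sigma\in\mathcal{S}^0_n$, $$\mathrm{pat}_Q(\sigma)=\sum_{j\in X(\sigma)}2\big((13\text{-}2)(|\sigma|,j)+(2\text{-}31)(|\sigma|,j)\big)-\#X(\sigma)+\sum_{j\in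 Y(\sigma)}\big((13\text{-}2)(|\sigma|,j)+(2\text{-}31)(|\sigma|,j)\big).$$ For $\sigma\in\mathcal{S}^{00}_{n+1}$, $$\mathrm{pat}_R(\sigma)=\sum_{j\in X(\sigma)}2\big((13\text{-}2)(|\sigma|,j)+(2\text{-}31)(|\sigma|,j)-1\big)+\sum_{j\in Y(\sigma)}\big((13\text{-}2)(|\sigma|,j)+(2\text{-}31)(|\sigma|,j)\big)+\#Z(\sigma).$$ *)

(* Defs.v *)
From HB Require Import structures.
From mathcomp Require Import all_boot all_order all_fingroup all_algebra.

Set Implicit Arguments.
Unset Strict Implicit.
Unset Printing Implicit Defensive.

Import Order.TTheory GRing.Theory Num.Theory.
Local Open Scope ring_scope.

(* q is an indeterminate: identities live in Q(q)[t], t being the polynomial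
   variable.  The field Q(q) gives a meaning to q to an integer power and to
   the division by q - 1. *)
Definition Kq : fieldType := {fraction {poly rat}}.
Definition qv : Kq := tofrac ('X : {poly rat}).

Definition qint (K : fieldType) (q : K) (m : nat) : K := \sum_(i < m) q ^+ i.

(* The division is exact, see Dq_spec. *)
Definition Dq (K : fieldType) (q : K) (f : {poly K}) : {poly K} :=
  (f \Po (q *: 'X) - f) %/ ((q - 1) *: 'X).

Definition Ut (K : fieldType) (f : {poly K}) : {poly K} := 'X * f.

Definition Qpoly (K : fieldType) (q : K) (n : nat) : {poly K} :=
  iter n (fun f => Dq q f + Ut (Dq q (Ut f))) 1.

Definition Rpoly (K : fieldType) (q : K) (n : nat) : {poly K} :=
  iter n (fun f => Dq q f + Dq q (Ut (Ut f))) 1.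

Lemma qv_neq0 : qv != 0.
Proof. by rewrite tofrac_eq0 polyX_eq0. Qed.

Lemma qv_neq1 : qv != 1.
Proof.
rewrite -tofrac1 tofrac_eq; apply/eqP => /(congr1 (fun p : {poly rat} => p`_1)).
by rewrite coefX coef1.
Qed.

Lemma Dq_spec (K : fieldType) (q : K) (f : {poly K}) : q != 1 ->
  Dq q f * ((q - 1) *: 'X) = f \Po (q *: 'X) - f.
Proof.
move=> q1; rewrite /Dq; apply/eqP; rewrite eq_sym -dvdp_eq dvdpZl ?subr_eq0 //.
have dvdX (g : {poly K}) : ('X %| g) = root g 0.
  by rewrite -dvdp_XsubCl polyC0 subr0.
by rewrite dvdX /root hornerD hornerN horner_comp hornerZ hornerX mulr0 subrr.
Qed.

Lemma Dq_Xn (K : fieldType) (q : K) (m : nat) : q != 1 ->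
  Dq q 'X^m = qint q m *: 'X^(m.-1).
Proof.
move=> q1.
have nz : (q - 1) *: 'X != 0 :> {poly K}.
  by rewrite scaler_eq0 subr_eq0 (negPf q1) polyX_eq0.
apply: (mulIf nz); rewrite Dq_spec // comp_Xn_poly exprZn.
rewrite -scalerAl -scalerAr scalerA mulrC -subrX1.
case: m => [|m]; first by rewrite !expr0 subrr !scale0r scale1r subrr.
by rewrite /= -exprSr scalerBl scale1r.
Qed.

(* [(false, k)] stands for k+1 and [(true, k)] for -(k+1). *)
Definition pmset (N : nat) : finType := (bool * 'I_N)%type.

Definition pmval (N : nat) (x : pmset N) : int := (-1) ^+ x.1 * (x.2.+1)%:Z.

Definition pmopp (N : nat) (x : pmset N) : pmset N := (~~ x.1, x.2).

Definition signed_perm (N : nat) (s : {perm pmset N}) : bool :=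
  [forall x, s (pmopp x) == pmopp (s x)].

(* The word of s with sigma_0 = 0 and sigma_(N+1) = b. *)
Definition word (N : nat) (b : int) (s : {perm pmset N}) (i : nat) : int :=
  if i is j.+1 then
    if insub j : option 'I_N is Some k then pmval (s (false, k)) else b
  else 0.

(* Only the entries sigma_1, ..., sigma_N matter in [snake], [S0] and [S00]; the
   boundary value 0 given to [word] there is never read. *)
Definition snake (N : nat) (s : {perm pmset N}) : bool :=
  let w := word 0 s in
  signed_perm s &&
  [forall i : 'I_N, (0 < i)%N ==> (if odd i then w i > w i.+1 else w i < w i.+1)].

Definition S0 (N : nat) : {set {perm pmset N}} :=
  [set s | snake s & (0 < N)%N ==> (0 < word 0 s 1)].

Definition S00 (N : nat) : {set {perm pmset N}} :=
  [set s in S0 N | (-1) ^+ N * word 0 s N < 0].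

Definition word0 (N : nat) (s : {perm pmset N}) : nat -> int :=
  word ((-1) ^+ N * (N.+1)%:Z) s.

Definition word00 (N : nat) (s : {perm pmset N}) : nat -> int := word 0 s.

Section Statistics.

(* Statistics of the word w_0 ... w_(N+1). *)
Variables (N : nat) (w : nat -> int).

Definition cs : nat := (\sum_(0 <= i < N.+1) (w i * w i.+1 < 0)%R)%N.

Definition aw (i : nat) : nat := `|w i|%N.

(* The position i in {1, ..., N} such that k = aw i. *)
Definition pos (k : nat) : nat := (index k [seq aw i | i <- iota 1 N]).+1.

Definition pat132 (k : nat) : nat :=
  (\sum_(0 <= j < (pos k).-1) ((aw j < k) && (k < aw j.+1)))%N.

Definition pat231 (k : nat) : nat :=
  (\sum_((pos k).+1 <= j < N.+1) ((aw j > k) && (k > aw j.+1)))%N.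

Definition tot231 : nat := (\sum_(1 <= k < N.+1) pat231 k)%N.

(* X, Y, Z are sets of values, listed without repetition when w comes from a
   signed permutation, since aw is then injective on {1, ..., N}. *)
Definition Xset : seq nat :=
  [seq aw i | i <- iota 1 N &
    [&& (aw i.-1 > aw i)%N, (aw i < aw i.+1)%N,
        w i.-1 * w i < 0 & w i * w i.+1 < 0]].

Definition Yset : seq nat :=
  [seq aw i | i <- iota 1 N &
    ((aw i.-1 < aw i) && (aw i < aw i.+1))%N ||
    ((aw i.-1 > aw i) && (aw i > aw i.+1))%N].

Definition Zset : seq nat :=
  [seq aw i | i <- iota 1 N & ((aw i.-1 < aw i) && (aw i > aw i.+1))%N].

Definition patQ : int :=
  \sum_(j <- Xset) 2 * ((pat132 j)%:Z + (pat231 j)%:Z) - (size Xset)%:Z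
  + \sum_(j <- Yset) ((pat132 j)%:Z + (pat231 j)%:Z).

Definition patR : int :=
  \sum_(j <- Xset) 2 * ((pat132 j)%:Z + (pat231 j)%:Z - 1)
  + \sum_(j <- Yset) ((pat132 j)%:Z + (pat231 j)%:Z) + (size Zset)%:Z.

End Statistics.

(* Main.v *)
Require Import Defs.
From mathcomp Require Import all_boot all_order all_fingroup all_algebra.
From mathcomp Require Import zify ring.

Set Implicit Arguments.
Unset Strict Implicit.
Unset Printing Implicit Defensive.

Import Order.TTheory GRing.Theory Num.Theory.
Local Open Scope ring_scope.

(** The two sides are compared through weighted insertion of the letters
    1, 2, ..., N into words with holes.

    Replace sigma_i by tau_i = (-1)^(i+1) sigma_i.  The snake inequalities
    become tau_i + tau_(i+1) > 0, so only a valley of |sigma| can carry a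
    negative tau, each valley chooses its sign freely, and sigma changes sign
    between i and i+1 exactly when tau_i tau_(i+1) > 0.  A snake is thus a
    permutation with a sign on each valley, and cs only depends on how many
    valleys are negative.

    Build such a word by inserting the letters in increasing order.  Letters
    still to come are grouped in maximal runs, and each run is written as one
    huge letter L, a hole.  Inserting M in a hole replaces L by M, by M L, by
    L M, or by L M L or L (-M) L: in the finished word M is then a peak, a
    double ascent, a double descent, or a valley of either sign.  Everything
    that the statistics say about the letter M is visible at that moment: the
    crossings (13-2) and (2-31) count the holes before and after M, and later
    insertions cannot alter them.  Hence the weight of a word is a product of
    insertion weights, and summing over the hole chosen gives a sum which
    depends on the number h of holes alone: with r letters to insert it is the
    polynomial [fillings r h], given by a three-term recurrence
    ([sum_expand_suffix], [sum_filled]).  The sequences of insertions are in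
    bijection with the words because the hole left by the largest letter can
    be recovered ([valid_parent], [collapse_expand]), and the full words are
    in bijection with the snakes ([perm_snake_words]).

    On the other side the relation D U = q U D + 1 gives
    D^h U = q^h U D^h + [h]_q D^(h-1), so that D^h Q_r and D^h R_r obey
    three-term recurrences in (r, h).  After division by [h]_q! these are the
    recurrences of [fillings] ([Qpoly_fillings], [Rpoly_fillings]); h = 0 is
    the theorem.

    Both families are treated together.  The boolean b is true for words
    0 tau_1 ... tau_N (N+1), whose last letter N+1 is itself a hole that never
    closes, and false for words 0 tau_1 ... tau_N 0. *)

(** * Iterated q-derivatives and the hole recurrence *)

Section QDerivative.
Variables (K : fieldType) (q : K).
Hypothesis q1 : q != 1.

Local Notation D := (Dq q).
Local Notation "[ h ]q" := (qint q h) (at level 0, format "[ h ]q").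

Lemma qintS h : [h.+1]q = [h]q + q ^+ h.
Proof. by rewrite /qint big_ord_recr. Qed.

Lemma qintSl h : [h.+1]q = 1 + q * [h]q.
Proof.
by rewrite /qint big_ord_recl expr0 mulr_sumr; under eq_bigr do rewrite exprS.
Qed.

Lemma qint0 : [0]q = 0. Proof. by rewrite /qint big_ord0. Qed.

Let nz : (q - 1) *: 'X != 0 :> {poly K}.
Proof. by rewrite scaler_eq0 subr_eq0 (negPf q1) polyX_eq0. Qed.

Lemma DqD f g : D (f + g) = D f + D g.
Proof.
by apply: (mulIf nz); rewrite mulrDl !Dq_spec // comp_polyD; ring.
Qed.

Lemma DqZ c f : D (c *: f) = c *: D f.
Proof.
by apply: (mulIf nz); rewrite -scalerAl !Dq_spec // comp_polyZ scalerBr.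
Qed.

Lemma DqX f : D ('X * f) = q *: ('X * D f) + f.
Proof.
apply: (mulIf nz); rewrite mulrDl -scalerAl -mulrA !Dq_spec // comp_polyM.
by rewrite comp_polyX -!mul_polyC polyCB polyC1; ring.
Qed.

Lemma iterDqD h f g : iter h D (f + g) = iter h D f + iter h D g.
Proof. by elim: h => //= h ->; rewrite DqD. Qed.

(** Each exchange of D and U costs a factor q and, by D U = q U D + 1, leaves a
    term without U; the h terms add up to [h]_q. *)
Lemma iterDqX h f :
  iter h D ('X * f) = q ^+ h *: ('X * iter h D f) + [h]q *: iter h.-1 D f.
Proof.
elim: h => [|h IH]; first by rewrite qint0 expr0 scale1r scale0r addr0.
rewrite iterS IH DqD !DqZ DqX qintS exprS -!mul_polyC !polyCD polyCM /=.
by case: h {IH} => [|h]; rewrite ?qint0 ?polyC0 /=; ring.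
Qed.

Variable b : bool.

(** Total weight of the insertions of one letter in one of the last r holes of
    a word with H holes and, if e holds, in its last letter; F values the
    words by their number of holes.  The three terms are the insertions that
    close a hole (peaks), keep it (double ascents and descents) or split it
    (valleys of both signs).  The powers of q summed over the r holes make
    [r]_q. *)
Definition step_sum (F : nat -> {poly K}) (H r : nat) (e : bool) : {poly K} :=
  (q ^+ (~~ b) * [r]q) *: F H.-1
  + (q ^+ H * ((q + 1) * [r]q + e%:R)) *: ('X * F H)
  + (q * [r]q + e%:R) *: ((1 + q ^+ (H.*2 + b)%N *: 'X^2) * F H.+1).

(** Generating function of the ways to close h holes by r insertions. *)
Fixpoint fillings (r h : nat) : {poly K} :=
  if r is r'.+1 then step_sum (fillings r') h h b else (h == 0)%:R.

Lemma fillingsS r h : fillings r.+1 h =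
    (q ^+ (~~ b) * [h]q) *: fillings r h.-1
    + (q ^+ h * ((q + 1) * [h]q + b%:R)) *: ('X * fillings r h)
    + (q * [h]q + b%:R) *: ((1 + q ^+ (h.*2 + b)%N *: 'X^2) * fillings r h.+1).
Proof. by []. Qed.

Lemma expr_double_bool (c : bool) k : q ^+ (k.*2 + c) = q ^+ c * (q ^+ k * q ^+ k).
Proof. by rewrite addnC exprD -addnn exprD. Qed.

Definition qfact h : K := \prod_(i < h) [i.+1]q.

Lemma qfactS h : qfact h.+1 = qfact h * [h.+1]q.
Proof. by rewrite /qfact big_ord_recr. Qed.
End QDerivative.

Section IteratedOperators.
Variables (K : fieldType) (q : K).
Hypothesis q1 : q != 1.
Local Notation D := (Dq q).

Lemma iterDq1 h : iter h D 1 = (h == 0)%:R.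
Proof.
have D0 : D 0 = 0 by have := DqZ q1 0 0; rewrite !scale0r.
have D1 : D 1 = 0 by have := Dq_Xn 0 q1; rewrite expr0 qint0 scale0r.
by case: h => // h; rewrite iterSr D1; elim: h => //= h ->.
Qed.

(** Moving D^h through D + U D U gives
    D^h Q_(r+1) = (1 + q^(2h+1) t^2) D^(h+1) Q_r
      + q^h ([h]_q + [h+1]_q) t D^h Q_r + [h]_q^2 D^(h-1) Q_r,
    which is the recurrence of [fillings] multiplied by [h]_q!. *)
Lemma Qpoly_fillings r h :
  iter h D (Qpoly q r) = qfact q h *: fillings q true r h.
Proof.
elim: r h => [|r IH] h.
  rewrite iterDq1 /=; case: h => [|h]; last by rewrite scaler0.
  by rewrite /qfact big_ord0 scale1r.
rewrite /Qpoly iterS -/(Qpoly q r) iterDqD // -iterSr /Ut iterDqX //.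
rewrite fillingsS -!iterSr !iterDqX // -?iterS [_.+1.-1]/= !IH -!mul_polyC.
case: h => [|h]; rewrite [in LHS]/= ?IH !qfactS !qintSl ?qint0 -?mul_polyC.
  by rewrite !(expr_double_bool, polyCD, polyCM, polyC0, polyC1) /=; ring.
by rewrite !(expr_double_bool, exprS, polyCD, polyCM, polyC1) /=; ring.
Qed.

(** A word 0 u 0 in which no hole is left admits no further insertion. *)
Lemma fillings_false0 r : fillings q false r.+1 0 = 0.
Proof. by rewrite fillingsS qint0 !(mulr0, addr0, scale0r). Qed.

(** Here D + D U U = D (1 + U^2), whose derivatives give
    D^h R_(r+1) = (1 + q^(2h+2) t^2) D^(h+1) R_r
      + [h+1]_q (q^h + q^(h+1)) t D^h R_r + [h+1]_q [h]_q D^(h-1) R_r.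
    The index h corresponds to h + 1 holes, the word 0 L 0 with one hole being
    the start; and each insertion carries an extra factor q, whence the power
    of q on the left. *)
Lemma Rpoly_fillings r h :
  q ^+ r.+1 *: iter h D (Rpoly q r) = qfact q h *: fillings q false r.+1 h.+1.
Proof.
elim: r h => [|r IH] h.
  rewrite iterDq1 /= /step_sum.
  case: h => [|h]; last by rewrite !(mulr0, scaler0, addr0).
  by rewrite /qfact big_ord0 !(mulr0, scaler0, addr0) qintS qint0 add0r mulr1 !scale1r.
rewrite /Rpoly iterS -/(Rpoly q r) iterDqD // -!iterSr /Ut !iterDqX // [_.+1.-1]/=.
rewrite fillingsS -!mul_polyC.
pose f k := iter k D (Rpoly q r); rewrite -?iterS -/(f h.+1) -/(f h) -/(f h.-1).
pose c : {poly K} := (q ^+ r.+1)%:P.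
have {}IH k : c * f k = (qfact q k)%:P * fillings q false r.+1 k.+1.
  by rewrite !mul_polyC IH.
rewrite [q ^+ r.+2]exprS polyCM -/c; clearbody c f.
(* Group c with each derivative of R_r, as in the induction hypothesis. *)
transitivity (q%:P * (c * f h.+1 + (q ^+ h.+1)%:P * ('X * ((q ^+ h.+1)%:P * ('X * (c * f h.+1))
  + (qint q h.+1)%:P * (c * f h)))
  + (qint q h.+1)%:P * ((q ^+ h)%:P * ('X * (c * f h)) + (qint q h)%:P * (c * f h.-1)))).
  by ring.
rewrite !IH qfactS.
case: h => [|h].
  rewrite fillings_false0 !qintSl qint0.
  by rewrite !(expr_double_bool, exprS, polyCD, polyCM, polyC0, polyC1) /=; ring.
rewrite !qfactS.
by rewrite !(expr_double_bool, exprS, polyCD, polyCM, polyC0, polyC1) /=; ring.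
Qed.
End IteratedOperators.

(** * Consecutive letters and the statistic of a word *)

Section Pairs.
Variables (T : Type) (P : T -> T -> bool).

Fixpoint pairs (s : seq T) : nat :=
  if s is x :: s' then ((if s' is y :: _ then P x y else false) + pairs s')%N
  else 0%N.

Lemma pairs_cons x y s : pairs [:: x, y & s] = (P x y + pairs (y :: s))%N.
Proof. by []. Qed.

Lemma pairs_cat a x c : pairs (rcons a x ++ c) = (pairs (rcons a x) + pairs (x :: c))%N.
Proof. by elim: a => [|y [|z a] IH] //=; rewrite -addnA; congr addn. Qed.

Lemma pairs_nth x0 s :
  pairs s = (\sum_(0 <= j < (size s).-1) P (nth x0 s j) (nth x0 s j.+1))%N.
Proof.
elim: s => [|x [|y s] IH]; [by rewrite big_geq..|].
by rewrite big_nat_recl // [LHS]/= -/(pairs (y :: s)) IH.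
Qed.

Variable B : pred T.
Hypothesis PB : forall y y', B y -> B y' -> P y y' = false.
Hypothesis PBr : forall x y y', B y -> B y' -> P x y = P x y'.
Hypothesis PBl : forall x y y', B y -> B y' -> P y x = P y' x.

(** If P does not distinguish the letters of B, and relates no two of them, a
    run of such letters counts like a single one. *)
Lemma pairs_subst a y s y' s' c : all B (y :: s) -> all B (y' :: s') ->
  pairs (a ++ y :: s ++ c) = pairs (a ++ y' :: s' ++ c).
Proof.
have E u v : all B (u :: v) -> pairs (u :: v ++ c) = pairs (u :: c).
  elim: v u => [|w v IH] u //= /and3P[Bu Bw Bv].
  by rewrite -/(pairs (w :: v ++ c)) PB // IH /= ?Bw //; case: c {IH} => // x c; rewrite (PBl x Bu Bw).
move=> Bs Bs'; have [[By _] [By' _]] := (andP Bs, andP Bs').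
elim: a => [|x [|z a] IH].
- by rewrite !E //; case: c {E} => // x c; rewrite /= (PBl x By By').
- by move: IH; rewrite !cat0s /= (PBr x By By') => ->.
- by congr addn; exact: IH.
Qed.
End Pairs.

Section Statistic.
Variables (b : bool) (L : int).
Implicit Types (p w s a c : seq int) (x y : int) (k : nat).

(** Before a letter of absolute value k, [rises k] counts its patterns 13-2;
    after it, [falls k] counts its patterns 2-31. *)
Definition rises k s := pairs (fun x y : int => (`|x| < k < `|y|)%N) s.
Definition falls k s := pairs (fun x y : int => (`|y| < k < `|x|)%N) s.

(** Contribution to the exponent of q of a letter x standing between p and s.
    The first summand is its part of the total (2-31), the others are its
    parts as a positive valley, as a double ascent or descent, and as a peak.
    The constants are those of both statistics at once: 2 g - 1 and 0 if b
    holds, 2 (g - 1) and 1 otherwise.  Boundary zeros and holes contribute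
    nothing. *)
Definition letter_stat p x s : int :=
  let k := `|x|%N in let l := `|last 0%R p|%N in let r := `|head 0%R s|%N in
  let d := (falls k s)%:Z in let g := (rises k p)%:Z + d in
  if (0 < k)%N && (x != L) then
    d + (if [&& (k < l)%N, (k < r)%N & 0 < x] then 2 * g - 2 + b%:Z else 0)
      + (if ((l < k < r) || (r < k < l))%N then g else 0)
      + (if ((l < k) && (r < k))%N then (~~ b)%:Z else 0)
  else 0.

(** Contribution of the letters of w inside the word p w s. *)
Fixpoint stat p w s : int :=
  if w is x :: w' then letter_stat p x (w' ++ s) + stat (rcons p x) w' s else 0.

Lemma stat_cat p u v s : stat p (u ++ v) s = stat p u (v ++ s) + stat (p ++ u) v s.
Proof.
elim: u p => [|x u IH] p /=; first by rewrite cats0 add0r.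
by rewrite IH -catA addrA cat_rcons.
Qed.

Lemma falls_subst k a y u y' u' c :
  all (fun z : int => k < `|z|)%N (y :: u) -> all (fun z : int => k < `|z|)%N (y' :: u') ->
  falls k (a ++ y :: u ++ c) = falls k (a ++ y' :: u' ++ c).
Proof. by apply: pairs_subst => *; lia. Qed.

Lemma rises_subst k a y u y' u' c :
  all (fun z : int => k < `|z|)%N (y :: u) -> all (fun z : int => k < `|z|)%N (y' :: u') ->
  rises k (a ++ y :: u ++ c) = rises k (a ++ y' :: u' ++ c).
Proof. by apply: pairs_subst => *; lia. Qed.

Variable M : nat.
Hypothesis ML : M%:Z < L.
(** The letters of a word into which M is about to be inserted. *)
Definition low_letter x := (x == L) || (`|x| < M)%N.

(** A letter below M cannot tell apart two nonempty runs of letters that are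
    all at least M: it is compared with a run only through the crossings and
    through its neighbours.  So exchanging two such runs alters the statistic
    by the contributions of the runs themselves. *)
Lemma stat_subst a y u y' u' c :
  all (fun z : int => M <= `|z|)%N (y :: u) ->
  all (fun z : int => M <= `|z|)%N (y' :: u') -> all low_letter (a ++ c) ->
  stat [::] (a ++ y :: u ++ c) [::] - stat a (y :: u) c =
  stat [::] (a ++ y' :: u' ++ c) [::] - stat a (y' :: u') c.
Proof.
move=> Bu Bu'; rewrite all_cat => /andP[Sa Sc].
have big k z v : (k < M)%N -> all (fun z : int => M <= `|z|)%N (z :: v) ->
    all (fun z : int => k < `|z|)%N (z :: v).
  by move=> kM; apply: sub_all => ?; apply: leq_trans.
have Ea p : stat p a (y :: u ++ c) = stat p a (y' :: u' ++ c).
  elim: a p Sa => [|x a IH] p //= /andP[Sx Sa]; rewrite IH //; congr (_ + _).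
  rewrite /letter_stat; case: ifP => // /andP[_ xL].
  have kM : (`|x| < M)%N by move: Sx; rewrite /low_letter (negPf xL).
  rewrite (falls_subst _ _ (big _ _ _ kM Bu) (big _ _ _ kM Bu')).
  move: Bu Bu' => /= /andP[By _] /andP[By' _].
  case: a {IH Sa} => [|z a] //=.
  have [y0 y0'] : (`|y| < `|x|)%N = false /\ (`|y'| < `|x|)%N = false by lia.
  have [y1 y1'] : (`|x| < `|y|)%N /\ (`|x| < `|y'|)%N by lia.
  by rewrite y1 y1' y0 y0'.
have Ec p : stat (a ++ y :: u ++ p) c [::] = stat (a ++ y' :: u' ++ p) c [::].
  elim: c p Sc {Ea} => [|x c IH] p //= /andP[Sx Sc].
  rewrite !rcons_cat /= !rcons_cat IH //; congr (_ + _).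
  rewrite /letter_stat; case: ifP => // /andP[_ xL].
  have kM : (`|x| < M)%N by move: Sx; rewrite /low_letter (negPf xL).
  rewrite (rises_subst _ _ (big _ _ _ kM Bu) (big _ _ _ kM Bu')).
  rewrite !last_cat /= !last_cat.
  case: p => [|z p] //=.
  have lastb z v : all (fun z : int => M <= `|z|)%N (z :: v) -> (M <= `|last z v|)%N.
    by move/allP; apply; apply: mem_last.
  have [y1 y2] := (lastb _ _ Bu, lastb _ _ Bu').
  have [y0 y0'] : (`|last y u| < `|x|)%N = false /\ (`|last y' u'| < `|x|)%N = false by lia.
  have [y3 y3'] : (`|x| < `|last y u|)%N /\ (`|x| < `|last y' u'|)%N by lia.
  by rewrite y3 y3' y0 y0'.
have := Ec [::]; rewrite !cats0 => {}Ec.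
rewrite -[y :: u ++ c]/((y :: u) ++ c) -[y' :: u' ++ c]/((y' :: u') ++ c).
rewrite !stat_cat !cats0 !cat0s [stat [::] a _]Ea Ec.
set A := stat [::] _ _; set B := stat a _ c; set B' := stat a _ c; ring.
Qed.

End Statistic.

(** * Inserting one letter *)

Section Insertion.
Variables (b : bool) (L : int).
Implicit Types (p w s a c : seq int) (x y : int) (k : nat).

(** The snake condition in terms of tau; two holes are never adjacent, since a
    hole stands for a maximal run. *)
Definition linked x y := (0 < x + y) && ((x != L) || (y != L)).

Variable M : nat.
Hypotheses (M0 : (0 < M)%N) (ML : M%:Z < L).
Local Notation small := (low_letter L M).

Let L0 : 0 < L. Proof. lia. Qed.

(** Every hole other than the first letter follows a low letter, and thus ends
    a pattern 13-2 of M; symmetrically below, where a hole in last position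
    precedes nothing and makes no pattern 2-31. *)
Lemma rises_count x a : all small (x :: a) -> path linked x a ->
  rises M (x :: a) = count_mem L a.
Proof.
elim: a x => [|y a IH] x // /and3P[Sx Sy Sa] /andP[e_xy e_a].
rewrite /rises pairs_cons -/(rises M (y :: a)) IH //; last exact/andP.
rewrite /linked /low_letter /= in Sx Sy e_xy *.
by congr addn; lia.
Qed.

Lemma falls_count x c : all small (x :: c) -> path linked x c ->
  (falls M (x :: c) + (last x c == L))%N = count_mem L (x :: c).
Proof.
elim: c x => [|y c IH] x; first by rewrite /falls /=; lia.
case/and3P=> Sx Sy Sa /andP[e_xy e_a].
rewrite /falls pairs_cons -/(falls M (y :: c)) -addnA IH //; last exact/andP.
rewrite /linked /low_letter /= in Sx Sy e_xy *.
by congr addn; lia.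
Qed.

(** The statistic of M in each of its five positions around a hole that has
    the word x0 a before it, with u holes, and c after it.  The number r counts
    the holes of c that do not end the word, and nf says whether the hole itself
    does not. *)
Section LetterStat.
Variables (x0 : int) (a c : seq int).
Hypotheses (Sa : all small (x0 :: a)) (Sc : all small c).
Hypotheses (x0L : x0 != L) (ea : path linked x0 (a ++ L :: c)).
Let u := count_mem L a.
Let r := falls M c.
Let nf := c != [::].

Let last_small : (`|last x0 a| < M)%N.
Proof.
have := allP Sa _ (mem_last x0 a).
by move: ea; rewrite cat_path /= /low_letter /linked => /and3P[_ ]; lia.
Qed.

Let head_small : nf -> (`|head 0%R c| < M)%N.
Proof.
move: ea; rewrite /nf cat_path; case: c Sc => [|y s] //= /andP[Sy _].
by move=> /and4P[_ _]; rewrite /low_letter /linked in Sy *; lia.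
Qed.

Let rises_a : rises M (x0 :: a) = u.
Proof. by apply: rises_count => //; move: ea; rewrite cat_path => /andP[]. Qed.

Let rises_aL : rises M (rcons (x0 :: a) L) = u.+1.
Proof.
rewrite rcons_cons rises_count.
- by rewrite -cats1 count_cat /= eqxx addn0 addn1.
- by rewrite -rcons_cons all_rcons Sa {1}/low_letter eqxx.
- by rewrite rcons_path; move: ea; rewrite cat_path /= => /and3P[-> ->].
Qed.

Lemma falls_hole : falls M (L :: c) = (nf + r)%N.
Proof.
move: head_small; rewrite /r /nf; case: (c) => [|y s] // ys.
have hy : (`|y| < M)%N := ys isT.
by rewrite /falls pairs_cons (_ : (`|y| < M < `|L|)%N) //; lia.
Qed.

Let absML : (`|M%:Z| < `|L|)%N. Proof. lia. Qed.

Lemma letter_stat_peak : nf ->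
  letter_stat b L (x0 :: a) M%:Z c = (r + ~~ b)%:Z.
Proof.
move=> /head_small hc; rewrite /letter_stat rises_a -/r /=.
have -> : (M%:Z != L) by lia.
have [-> ->] : (`|last x0 a| < M)%N = true /\ (M < `|last x0 a|)%N = false by lia.
have [-> ->] : (`|head 0%R c| < M)%N = true /\ (M < `|head 0%R c|)%N = false by lia.
by rewrite M0 /=; lia.
Qed.

Lemma letter_stat_asc :
  letter_stat b L (x0 :: a) M%:Z (L :: c) = ((nf + r) + (u + nf + r))%:Z.
Proof.
rewrite /letter_stat rises_a falls_hole /=.
have -> : (M%:Z != L) by lia.
have [-> ->] : (`|last x0 a| < M)%N = true /\ (M < `|last x0 a|)%N = false by lia.
have [-> ->] : (`|L| < M)%N = false /\ (M < `|L|)%N by lia.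
by rewrite M0 /=; lia.
Qed.

Lemma letter_stat_desc : nf ->
  letter_stat b L (rcons (x0 :: a) L) M%:Z c = (r + (u.+1 + r))%:Z.
Proof.
move=> /head_small hc; rewrite /letter_stat rises_aL -/r last_rcons.
have -> : (M%:Z != L) by lia.
have [-> ->] : (`|head 0%R c| < `|M%:Z|)%N = true /\ (`|M%:Z| < `|head 0%R c|)%N = false by lia.
have [-> ->] : (`|L| < `|M%:Z|)%N = false /\ (`|M%:Z| < `|L|)%N by lia.
by rewrite M0 /=; lia.
Qed.

Lemma letter_stat_valley :
  letter_stat b L (rcons (x0 :: a) L) M%:Z (L :: c) = ((nf + r) + 2 * (u + nf + r) + b)%:Z.
Proof.
rewrite /letter_stat rises_aL last_rcons falls_hole /=.
have -> : (M%:Z != L) by lia.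
have [-> ->] : (`|L| < M)%N = false /\ (M < `|L|)%N by lia.
by rewrite M0 ltz_nat M0 /=; lia.
Qed.

Lemma letter_stat_negative_valley :
  letter_stat b L (rcons (x0 :: a) L) (- M%:Z) (L :: c) = (nf + r)%:Z.
Proof.
rewrite /letter_stat abszN rises_aL last_rcons falls_hole /=.
have -> : (- M%:Z != L) by lia.
have [-> ->] : (`|L| < M)%N = false /\ (M < `|L|)%N by lia.
have -> : (0 < - M%:Z) = false by lia.
by rewrite M0 /=; lia.
Qed.

End LetterStat.

(** The exponent of t, as tau_i tau_(i+1) > 0 iff sigma changes sign. *)
Definition sign_pairs w := pairs (fun x y : int => 0 < x * y) w.

(** The runs that can replace a hole followed by c.  A hole in last position is
    the boundary value N+1 and has to stay, so that c = [::] only admits the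
    runs that end with a hole. *)
Definition fills c : seq (seq int) :=
  [:: [:: L; M%:Z; L]; [:: L; - M%:Z; L]; [:: M%:Z; L]] ++
  (if c is _ :: _ then [:: [:: M%:Z]; [:: L; M%:Z]] else [::]).

Fixpoint expand w : seq (seq int) :=
  if w is x :: c then
    (if x == L then [seq u ++ c | u <- fills c] else [::])
    ++ [seq x :: w' | w' <- expand c]
  else [::].

Lemma expand_cons x c : expand (x :: c) =
  (if x == L then [seq u ++ c | u <- fills c] else [::]) ++
  [seq x :: w' | w' <- expand c].
Proof. by []. Qed.

Lemma sign_pairs_fill x0 a c :
  let S := sign_pairs (x0 :: a ++ L :: c) in
  [/\ sign_pairs (x0 :: a ++ [:: L; M%:Z; L] ++ c) = S.+2,
      sign_pairs (x0 :: a ++ [:: L; - M%:Z; L] ++ c) = S,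
      sign_pairs (x0 :: a ++ [:: M%:Z; L] ++ c) = S.+1,
      sign_pairs (x0 :: a ++ [:: M%:Z] ++ c) = S &
      sign_pairs (x0 :: a ++ [:: L; M%:Z] ++ c) = S.+1].
Proof.
have M1 : 0 < M%:Z by lia.
have rL x : (0 < x * L) = (0 < x) by rewrite pmulr_lgt0.
have rM x : (0 < x * M%:Z) = (0 < x) by rewrite pmulr_lgt0.
have lL x : (0 < L * x) = (0 < x) by rewrite pmulr_rgt0.
have lM x : (0 < M%:Z * x) = (0 < x) by rewrite pmulr_rgt0.
have [a' [l]] : exists a' l, x0 :: a = rcons a' l.
  by case/lastP: a => [|a l]; [exists [::], x0 | exists (x0 :: a), l].
rewrite -!cat_cons => ->; rewrite /sign_pairs !pairs_cat /=.
rewrite !(rL, rM, lL, lM, mulNr, mulrN, oppr_gt0) L0 M1.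
have -> : (M%:Z < 0) = false by lia.
by case: c => [|y c]; rewrite ?(lL, lM); split; lia.
Qed.

End Insertion.

(** * The sum over the insertions of one letter *)

Section Weight.
Variables (K : fieldType) (q : K).
Hypothesis (q0 : q != 0).
Variables (b : bool) (L : int).
Implicit Types (p w s a c u : seq int) (x y : int) (k : nat).

Definition weight w : {poly K} := q ^ stat b L [::] w [::] *: 'X^(sign_pairs w).
(** If b holds, the last letter L is a boundary value and is not counted. *)
Definition holes w := (count_mem L w - b)%N.

Variable M : nat.
Hypotheses (M0 : (0 < M)%N) (ML : M%:Z < L).
Local Notation small := (low_letter L M).
Local Notation edge := (linked L).

Lemma weight_fill a y u c (e d : nat) :
  all (fun z : int => M <= `|z|)%N (y :: u) -> all small (a ++ c) ->
  stat b L a (y :: u) c = e ->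
  sign_pairs (a ++ y :: u ++ c) = (sign_pairs (a ++ L :: c) + d)%N ->
  weight (a ++ y :: u ++ c) = (q ^+ e *: 'X^d) * weight (a ++ L :: c).
Proof.
move=> Bu S Ee Ed; rewrite /weight Ed exprD.
have B1 : all (fun z : int => M <= `|z|)%N [:: L] by rewrite /=; lia.
have := stat_subst b ML Bu B1 S; have -> : stat b L a [:: L] c = 0 by rewrite /= /letter_stat eqxx andbF addr0.
rewrite Ee subr0 => /eqP; rewrite subr_eq => /eqP ->.
rewrite addrC expfzDr // -scalerAl -scalerAr scalerA; congr (_ *: _).
by rewrite mulrC.
Qed.

Lemma sum_fills (G : seq int -> {poly K}) c :
  \sum_(w <- [seq u ++ c | u <- fills L M c]) G w =
  G ([:: L; M%:Z; L] ++ c) + G ([:: L; - M%:Z; L] ++ c) + G ([:: M%:Z; L] ++ c)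
  + (if c == [::] then 0 else G ([:: M%:Z] ++ c) + G ([:: L; M%:Z] ++ c)).
Proof.
by rewrite big_map; case: c => [|y c]; rewrite !big_cons big_nil !addrA addr0.
Qed.

(** Restricting the insertions to the suffix c makes an induction on c possible:
    the holes of c are numbered r-1, ..., 0 by the holes that follow them, and
    the hole with r-1 after it contributes q^(r-1) to each bracket [r]_q.  The
    total number of holes enters only through g = (13-2) + (2-31), which does
    not depend on the hole chosen. *)
Lemma sum_expand_suffix (F : nat -> {poly K}) x0 a c :
  all small (x0 :: a ++ c) -> x0 != L -> path edge x0 (a ++ c) ->
  (last x0 (a ++ c) == L) = b ->
  \sum_(w <- expand L M c) weight (x0 :: a ++ w) * F (holes (x0 :: a ++ w)) =
  weight (x0 :: a ++ c) *
    step_sum q b F (holes (x0 :: a ++ c)) (falls M c) (last 0 c == L).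
Proof.
have L0 : L == 0 = false by lia.
elim: c a => [|x c IH] a Sac x0L eac lastb.
  by rewrite big_nil /step_sum /falls /= eq_sym L0 qint0 !(mulr0, addr0, scale0r).
have cat_x w : a ++ x :: w = rcons a x ++ w by rewrite cat_rcons.
have {}IH := IH (rcons a x); rewrite -cat_x in IH.
have -> : \sum_(w <- expand L M (x :: c)) weight (x0 :: a ++ w) * F (holes (x0 :: a ++ w)) =
    \sum_(w <- (if x == L then [seq u ++ c | u <- fills L M c] else [::]))
       weight (x0 :: a ++ w) * F (holes (x0 :: a ++ w)) +
    weight (x0 :: a ++ x :: c) *
      step_sum q b F (holes (x0 :: a ++ x :: c)) (falls M c) (last 0 c == L).
  rewrite big_cat big_map; congr (_ + _).
  by under eq_bigr do rewrite cat_x; rewrite IH.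
have Sx : small x by move: Sac; rewrite /= all_cat /= => /and4P[].
have [xL | xL] := eqVneq x L; last first.
  rewrite big_nil [LHS]add0r.
  have -> : falls M (x :: c) = falls M c.
    rewrite /low_letter (negPf xL) /= in Sx.
    by case: c {IH Sac eac lastb cat_x} => // y c; rewrite /falls pairs_cons; lia.
  suff -> : (last 0 c == L) = (last 0 (x :: c) == L) by [].
  by case: c {IH Sac eac lastb cat_x} => //=; rewrite eq_sym L0 (negPf xL).
move: Sac eac lastb {Sx}; rewrite {x cat_x IH}xL => Sac eac lastb.
have Sa : all small (x0 :: a) by move: Sac; rewrite /= !all_cat => /and3P[-> ->].
have Sc : all small c by move: Sac; rewrite /= !all_cat => /and4P[].
have Sac' : all small ((x0 :: a) ++ c) by rewrite all_cat Sa.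
have fLc := falls_hole M0 ML Sa Sc x0L eac.
have [s1 s2 s3 s4 s5] := sign_pairs_fill M0 ML x0 a c.
have stL p s : letter_stat b L p L s = 0 by rewrite /letter_stat eqxx andbF.
have ML' : (M <= `|L|)%N by lia.
set u := count_mem L a; set r := falls M c; set W := weight (x0 :: a ++ L :: c).
have e1 : weight (x0 :: a ++ [:: L; M%:Z; L] ++ c) =
    (q ^+ ((c != [::]) + r + 2 * (u + (c != [::]) + r) + b) *: 'X^2) * W.
  apply: (@weight_fill (x0 :: a) L [:: M%:Z; L] c) => //; first by rewrite /= ML' leqnn.
    by rewrite /= !stL add0r !addr0 (letter_stat_valley b M0 ML Sa Sc).
  by apply: (etrans s1); rewrite addn2.
have e2 : weight (x0 :: a ++ [:: L; - M%:Z; L] ++ c) =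
    (q ^+ ((c != [::]) + r) *: 'X^0) * W.
  apply: (@weight_fill (x0 :: a) L [:: - M%:Z; L] c) => //; first by rewrite /= ML' abszN leqnn.
    by rewrite /= !stL add0r !addr0 (letter_stat_negative_valley b M0 ML Sa Sc).
  by apply: (etrans s2); rewrite addn0.
have e3 : weight (x0 :: a ++ [:: M%:Z; L] ++ c) =
    (q ^+ ((c != [::]) + r + (u + (c != [::]) + r)) *: 'X^1) * W.
  apply: (@weight_fill (x0 :: a) M%:Z [:: L] c) => //; first by rewrite /= ML' leqnn.
    by rewrite /= !stL !addr0 (letter_stat_asc b M0 ML Sa Sc).
  by apply: (etrans s3); rewrite addn1.
have e4 : c != [::] -> weight (x0 :: a ++ [:: M%:Z] ++ c) =
    (q ^+ (r + ~~ b) *: 'X^0) * W.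
  move=> nc; apply: (@weight_fill (x0 :: a) M%:Z [::] c) => //; first by rewrite /= leqnn.
    by rewrite /= !addr0 (letter_stat_peak b M0 ML Sa Sc).
  by apply: (etrans s4); rewrite addn0.
have e5 : c != [::] -> weight (x0 :: a ++ [:: L; M%:Z] ++ c) =
    (q ^+ (r + (u.+1 + r)) *: 'X^1) * W.
  move=> nc; apply: (@weight_fill (x0 :: a) L [:: M%:Z] c) => //; first by rewrite /= ML' leqnn.
    by rewrite /= !stL add0r !addr0 (letter_stat_desc b M0 ML Sa Sc).
  by apply: (etrans s5); rewrite addn1.
have ccount : count_mem L c = (r + (last 0%R c == L))%N.
  move: Sc eac; rewrite cat_path /r; case: (c) => [|y s] Ss.
    by rewrite /= eq_sym L0.
  by case/and4P=> _ _ _ es; rewrite -(falls_count M0 ML Ss es).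
have holesE v : holes (x0 :: a ++ v ++ c) = (u + count_mem L v + count_mem L c - b)%N.
  by rewrite /holes /= (negPf x0L) add0n !count_cat addnA.
have hL : (L == L) by []; have hM : (M%:Z == L) = false by lia.
have hNM : (- M%:Z == L) = false by lia.
have lastE : c != [::] -> (last 0 c == L) = b by move: lastb; rewrite last_cat; case: (c).
have lastN : c = [::] -> b by move: lastb; rewrite last_cat => + cN; rewrite cN /= eqxx.
have WF v (P : {poly K}) (H : nat) : weight (x0 :: a ++ v ++ c) = P * W ->
    (u + count_mem L v + count_mem L c - b = H)%N ->
    weight (x0 :: a ++ v ++ c) * F (holes (x0 :: a ++ v ++ c)) = W * (P * F H).
  by move=> -> <-; rewrite holesE [P * W]mulrC mulrA.
have holesL : holes (x0 :: a ++ L :: c) = (u + 1 + count_mem L c - b)%N.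
  by rewrite -[L :: c]/([:: L] ++ c) holesE /= eqxx.
have M'1 : count_mem L [:: L; M%:Z; L] = 2%N by rewrite /= eqxx hM.
have M'2 : count_mem L [:: L; - M%:Z; L] = 2%N by rewrite /= eqxx hNM.
have M'3 : count_mem L [:: M%:Z; L] = 1%N by rewrite /= eqxx hM.
have M'4 : count_mem L [:: M%:Z] = 0%N by rewrite /= hM.
have M'5 : count_mem L [:: L; M%:Z] = 1%N by rewrite /= eqxx hM.
clear hL hM hNM s1 s2 s3 s4 s5 stL Sa Sc Sac' holesE.
rewrite sum_fills holesL.
(* A hole in last position admits three insertions, any other hole five. *)
have [c0|c0] := eqVneq c [::].
  have bT := lastN c0; have r0 : r = 0%N by rewrite /r c0.
  have cL : count_mem L c = 0%N by rewrite c0.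
  rewrite (WF [:: _; _; _] _ u.+1 e1) ?(WF [:: _; _; _] _ u.+1 e2)
    ?(WF [:: _; _] _ u e3) ?M'1 ?M'2 ?M'3 ?cL ?bT ?addn0 ?addnK ?addn2 ?subn1 //.
  rewrite fLc r0 c0 eqxx [last _ [::]]/= [0 == L]eq_sym L0 [last _ _]/= eqxx /step_sum qint0 ?bT.
  rewrite !(muln0, addn0, add0n, add0r, mulr0, scale0r, expr0, expr1, mul2n, exprD).
  by rewrite -addnn exprD -!mul_polyC !polyCM ?polyC1 ?mul1r; ring.
have A k : (u + k + count_mem L c - b = k + (u + r))%N.
  by rewrite ccount lastE // addnA addnK addnAC addnC.
rewrite (WF [:: _; _; _] _ (u + r).+2 e1) ?(WF [:: _; _; _] _ (u + r).+2 e2)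
    ?(WF [:: _; _] _ (u + r).+1 e3) ?(WF [:: _] _ (u + r)%N (e4 c0))
    ?(WF [:: _; _] _ (u + r).+1 (e5 c0)) ?M'1 ?M'2 ?M'3 ?M'4 ?M'5 ?A ?lastE //.
have -> : (last 0 (L :: c) == L) = b by rewrite -lastE //; case: (c) c0.
rewrite fLc -/r c0 /step_sum qintS -addnn /= -addnA mul2n -addnn !addnA.
rewrite !(addSn, add0n, addn1, addnS, exprS, exprD) -!mul_polyC.
by rewrite !(polyCD, polyCM); ring.
Qed.

End Weight.

(** * Words with holes at level m *)

Section ValidWords.
Variables (b : bool) (L : int).
Implicit Types (p w s a c u : seq int) (x y : int) (k : nat).
Local Notation edge := (linked L).

Definition letters w := [seq `|x|%N | x <- w & x != L].

(** The words in which 1, ..., m have been inserted.  The boundary zeros, one or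
    two of them, are the letters of value 0. *)
Definition valid m w :=
  [&& head L w == 0, last 0 w == (if b then L else 0), sorted edge w
    & perm_eq (letters w) (nseq (~~ b) 0%N ++ iota 0 m.+1)].

Lemma letters_cat a c : letters (a ++ c) = letters a ++ letters c.
Proof. by rewrite /letters filter_cat map_cat. Qed.

Lemma letters_small m w :
  perm_eq (letters w) (nseq (~~ b) 0%N ++ iota 0 m.+1) -> all (low_letter L m.+1) w.
Proof.
move=> /perm_mem E; apply/allP => x xw; rewrite /low_letter.
have [//|xL /=] := eqVneq x L.
have : `|x|%N \in letters w by apply: map_f; rewrite mem_filter xL.
by rewrite E mem_cat mem_iota mem_nseq ltnS => /orP[/andP[_ /eqP ->]|/andP[]].
Qed.

Lemma valid_small m w : valid m w -> all (low_letter L m.+1) w.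
Proof. by case/and4P=> _ _ _; apply: letters_small. Qed.

Section OneLevel.
Variable m : nat.
Local Notation M := m.+1.
Hypothesis ML : M%:Z < L.
Local Notation small := (low_letter L M).

Let L0 : 0 < L. Proof. lia. Qed.

Lemma expandP w w' : reflect (exists a c u, [/\ w = a ++ L :: c, w' = a ++ u ++ c & u \in fills L M c])
  (w' \in expand L M w).
Proof.
apply: (iffP idP) => [|[a [c [u [-> -> uc]]]]].
  elim: w w' => [|x w IH] w' //; rewrite expand_cons mem_cat => /orP[|/mapP[v /IH[a [c [u [-> -> uc]]]] ->]].
    case: eqP => [-> /mapP[u uw ->]|_]; last by rewrite in_nil.
    by exists [::], w, u.
  by exists (x :: a), c, u.
elim: a => [|x a IH]; rewrite ?cat0s ?cat_cons expand_cons mem_cat.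
  by rewrite eqxx; apply/orP; left; apply/mapP; exists u.
by apply/orP; right; apply/mapP; exists (a ++ u ++ c).
Qed.

Lemma letters_fill a u c : u \in fills L M c ->
  perm_eq (letters (a ++ u ++ c)) (nseq (~~ b) 0%N ++ iota 0 m.+2) =
  perm_eq (letters (a ++ L :: c)) (nseq (~~ b) 0%N ++ iota 0 m.+1).
Proof.
move=> uc; rewrite !letters_cat.
have -> : letters u = [:: M].
  have ML1 : M%:Z != L by lia.
  have ML2 : - M%:Z != L by lia.
  move: uc; rewrite /fills /letters; case: c => [|y c]; rewrite !inE;
    [case/or3P | case/or3P=> [||/or3P[]]] => /eqP ->;
    by rewrite /= ?eqxx ?ML1 ?ML2 /= ?abszN.
have -> : letters (L :: c) = letters c by rewrite /letters /= eqxx.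
rewrite (permPl (_ : perm_eq _ (M :: letters a ++ letters c))); last first.
  by rewrite -cat1s perm_catCA.
rewrite -[m.+2]addn1 iotaD add0n catA -/M -[_ ++ iota M 1]/(_ ++ [:: M]) perm_sym.
by rewrite (permPl (_ : perm_eq _ (M :: nseq (~~ b) 0%N ++ iota 0 M))) ?perm_cons 1?perm_sym //
  ?perm_catC // -cat1s perm_catC.
Qed.

Lemma valid_fill a u c : u \in fills L M c -> valid m (a ++ L :: c) -> valid m.+1 (a ++ u ++ c).
Proof.
move=> uc g; have S := valid_small g; case/and4P: g => h l s p.
have pu : perm_eq (letters (a ++ u ++ c)) (nseq (~~ b) 0%N ++ iota 0 m.+2).
  by rewrite letters_fill.
case: a h l s p pu S => [|x0 a]; first by rewrite /= => /eqP L00; move: L0; rewrite L00.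
rewrite !cat_cons => h l s p pu S; rewrite /valid pu andbT.
rewrite h /=; apply/andP; split.
  move: l uc; rewrite /= !last_cat; case: c {h s p pu S} => [|y c] /=; last by move=> ->.
  by move/eqP=> <-; rewrite !inE => /or3P[] /eqP -> /=.
have := S; rewrite /= all_cat => /and4P[Sx Sa _ Sc].
have Sl : small (last x0 a).
  by have := mem_last x0 a; apply/allP => /=; rewrite Sx.
move: s; rewrite /sorted !cat_path => /andP[-> /=].
rewrite /linked /low_letter in Sl Sc *.
move: uc; rewrite /fills; case: c {l p pu S h} Sc => [|y c] /= Sc.
  by rewrite !inE => /or3P[] /eqP -> /=; lia.
move: Sc => /andP[Sy _].
by rewrite !inE => /or3P[|| /or3P[]] /eqP -> /= /and3P[e1 e2 ->]; lia.
Qed.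

(** The run u being maximal, that is, with no hole on either side, is what makes
    the word with a hole in its place valid. *)
Lemma valid_unfill a u c : u \in fills L M c -> valid m.+1 (a ++ u ++ c) ->
  a != [::] -> last 0 a != L -> head 0 c != L -> valid m (a ++ L :: c).
Proof.
move=> uc /and4P[h l s p] a0 la hc; rewrite letters_fill // in p.
have S := letters_small p; rewrite /valid p andbT.
case: a a0 h l s p S la => // x0 a _ h l s p S /= la.
move: (h) => /= -> /=; apply/andP; split.
  move: l; rewrite /= !last_cat; case: c {h s p hc} uc S => [|y c] uc _ //=.
  by move: uc; rewrite !inE => /or3P[] /eqP -> /=.
move: s; rewrite cat_cons /sorted !cat_path => /andP[-> /=].
move: S; rewrite /= all_cat => /and4P[Sx Sa _ Sc].
have Sl : small (last x0 a).
  by have := mem_last x0 a; apply/allP => /=; rewrite Sx.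
rewrite /linked /low_letter in Sl Sc *.
move: uc; rewrite /fills; case: c {l p h} hc Sc => [|y c] /= hc.
  by rewrite !inE => _ /or3P[] /eqP -> /=; lia.
move=> /andP[Sy _].
by rewrite !inE => /or3P[|| /or3P[]] /eqP -> /=; rewrite -?andbA => es;
   rewrite (_ : path _ y c); lia.
Qed.

(** Each word of level m+1 arises from an insertion: merge the letter m+1 with
    the holes next to it into a single hole.  The letter can only be negative
    between two holes, because its sum with a low neighbour is positive. *)
Lemma valid_parent w : valid m.+1 w ->
  exists a c u, [/\ u \in fills L M c, w = a ++ u ++ c & valid m (a ++ L :: c)].
Proof.
move=> g; have : M \in letters w.
  by case/and4P: g => _ _ _ /perm_mem ->; rewrite mem_cat mem_iota ltnSn orbT.
case/mapP=> x; rewrite mem_filter => /andP[xL xw] xM.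
case/splitPr: xw g => a c g.
suff [a' [c' [u [uc E a0 la hc]]]] : exists a' c' u, [/\ u \in fills L M c',
    a ++ x :: c = a' ++ u ++ c', a' != [::], last 0 a' != L & head 0 c' != L].
  by exists a', c', u; rewrite E in g *; split=> //; apply: valid_unfill uc g a0 la hc.
case/and4P: g => h l s p.
have S : all small (a ++ L :: c).
  apply: (@letters_small m); rewrite -(@letters_fill a [:: M%:Z; L] c); last first.
    by rewrite !inE eqxx !orbT.
  move: p; rewrite !letters_cat /letters /= eqxx xL (_ : M%:Z != L) /= -?xM //; lia.
case: a h l s S {p} => [|x0 a]; first by rewrite /= => /eqP x0; rewrite x0 in xM.
case: c => [|y c].
  rewrite /= last_cat /= => _; case: (b) => /eqP xe; last by rewrite xe in xM.
  by rewrite xe eqxx in xL.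
rewrite [head _ _]/= => /eqP x00 l; rewrite cat_cons /sorted cat_path /=.
rewrite all_cat /= => /and4P[ea el er ec] /andP[Sx0 /and3P[Sa _ /andP[Sy _]]].
have Sl : small (last x0 a).
  by have := mem_last x0 a; apply/allP => /=; rewrite Sx0.
have hc : y = L -> head 0 c != L.
  by move=> yL; move: ec; rewrite yL; case: (c) => [|z d] /=; rewrite /linked; lia.
rewrite /linked /low_letter in el er Sl Sy *.
have [lL|lL] := eqVneq (last x0 a) L.
  case/lastP: a lL ea {el Sl Sa l} => [|a z]; first by rewrite /= x00; lia.
  rewrite last_rcons => {z}->; rewrite rcons_path => /andP[_ el'].
  have la : last 0 (x0 :: a) != L by move: el'; rewrite /linked /=; lia.
  have [yL|yL] := eqVneq y L.
    exists (x0 :: a), c, [:: L; x; L]; split=> //; last exact: hc.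
      have [->|->] : x = M%:Z \/ x = - M%:Z by lia.
        by rewrite inE eqxx.
      by rewrite !inE eqxx !orbT.
    by rewrite cat_rcons yL.
  have -> : x = M%:Z by lia.
  exists (x0 :: a), (y :: c), [:: L; M%:Z]; split=> //; first by rewrite !inE eqxx !orbT.
  by rewrite cat_rcons.
have -> : x = M%:Z by move: el Sl lL xM; move: (last x0 a : int) (x : int) => z t; lia.
have [yL|yL] := eqVneq y L.
  exists (x0 :: a), c, [:: M%:Z; L]; split=> //; last exact: hc.
    by rewrite !inE eqxx !orbT.
  by rewrite yL.
by exists (x0 :: a), (y :: c), [:: M%:Z]; split=> //; rewrite !inE eqxx !orbT.
Qed.

(** Inverse of the insertion of M: turn M into a hole and merge adjacent
    holes. *)
Fixpoint collapse w :=
  if w is x :: c then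
    let y := if `|x|%N == M then L else x in
    if (y == L) && (head 0 (collapse c) == L) then collapse c else y :: collapse c
  else [::].

Lemma collapse_cons x c : collapse (x :: c) =
  let y := if `|x|%N == M then L else x in
  if (y == L) && (head 0 (collapse c) == L) then collapse c else y :: collapse c.
Proof. by []. Qed.

Let small_absM x : small x -> (`|x|%N == M) = false.
Proof. by rewrite /low_letter; lia. Qed.

Lemma collapse_id w : sorted edge w -> all small w -> collapse w = w.
Proof.
elim: w => // x w IH pw /andP[Sx Sw].
rewrite collapse_cons IH // ?small_absM //; last exact: path_sorted pw.
case: w pw {Sw IH} => [|y w]; first by rewrite /= (eq_sym 0) (gt_eqF L0) andbF.
by rewrite /= /linked => /andP[exy _]; rewrite (_ : (x == L) && (y == L) = false) //; lia.
Qed.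

Let head_after_hole w : sorted edge (L :: w) -> (head 0 w == L) = false.
Proof.
case: w => [|y w]; first by rewrite /= eq_sym gt_eqF.
by rewrite /= /linked; lia.
Qed.

Lemma collapse_expand w v : sorted edge w -> all small w ->
  v \in expand L M w -> collapse v = w.
Proof.
elim: w v => // x w IH v pw Sw; have [Sx Sw'] := andP Sw.
have pw' : sorted edge w by apply: path_sorted pw.
rewrite expand_cons mem_cat => /orP[|/mapP[v' v'w ->]]; last first.
  by rewrite collapse_cons (IH v') // -[in LHS](collapse_id pw' Sw') -collapse_cons collapse_id.
have [xL|xL] := eqVneq x L; last by rewrite in_nil.
rewrite {x}xL in pw Sx Sw * => /mapP[u uw ->].
have hw := head_after_hole pw; have idw := collapse_id pw' Sw'.
have cE z d : (`|z|%N == M) || (z == L) ->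
    collapse (z :: d) = if head 0 (collapse d) == L then collapse d else L :: collapse d.
  by rewrite collapse_cons; case: ifP => [_ _|_ /eqP ->]; rewrite /= eqxx.
have cL := cE L; have cM := cE M%:Z; have cN := cE (- M%:Z).
rewrite eqxx orbT in cL; rewrite eqxx in cM; rewrite abszN eqxx in cN.
move: uw; rewrite /fills; case: w hw idw {IH pw Sw Sw' pw'} => [|y w] hw idw;
  rewrite !inE; [case/or3P | case/or3P=> [||/or3P[]]] => /eqP ->;
  by rewrite [_ ++ _]/= ?cL // ?cM // ?cN // ?cL // idw /= hw /= ?eqxx.
Qed.

(** Different insertions in the same word differ already next to the hole that
    they fill, since low letters are neither holes nor equal to M or -M. *)
Lemma uniq_expand w : sorted edge w -> all small w -> uniq (expand L M w).
Proof.
elim: w => // x w IH pw Sw; have [Sx Sw'] := andP Sw.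
have pw' : sorted edge w by apply: path_sorted pw.
rewrite expand_cons cat_uniq (map_inj_uniq (_ : injective (cons x))) ?IH //; last by move=> ? ? [].
rewrite andbT; have [xL|xL] := eqVneq x L; last by apply/hasPn.
rewrite {x}xL in pw Sx Sw *; have hw := head_after_hole pw.
have mM : (M%:Z == L) = false by lia.
have mN : (- M%:Z == L) = false by lia.
have mNM : (M%:Z == - M%:Z) = false by lia.
have Lw : (L :: w == w) = false.
  by apply/eqP => /(congr1 size) /= /esym /n_Sn.
apply/andP; split.
  have mNM' : (- M%:Z == M%:Z) = false by rewrite eq_sym.
  move: Lw hw; rewrite /fills; case: (w) => [|y w'] Lw hw.
    by rewrite /= !inE !eqseq_cons !eqxx ?(eq_sym L) ?mM ?mN ?mNM.
  rewrite map_cat /= !inE !eqseq_cons !eqxx ?(eq_sym L) ?mM ?mN ?mNM ?mNM' ?Lw.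
  by rewrite [y == L]hw !(andbF, andFb).
apply/hasPn => v /mapP[v' v'w ->]; apply/negP => /mapP[u uf].
case: w v'w hw pw' Sw' uf {IH pw Sw Lw} => // y w.
rewrite expand_cons /= => + yL; rewrite yL /= => /mapP[v'' _ ->] _ /andP[Sy _].
have Sy' : (`|y| < M)%N by move: Sy; rewrite /low_letter yL.
rewrite /fills !inE => /or3P[|| /or3P[]] /eqP -> [] => [||||]; lia.
Qed.

End OneLevel.
End ValidWords.

(** * The sum over all words *)

Section States.
Variables (b : bool) (n : nat).
Let L : int := n.+1%:Z.

Fixpoint states m : seq (seq int) :=
  if m is m'.+1 then flatten [seq expand L m w | w <- states m']
  else [:: if b then [:: 0; L] else [:: 0; L; 0]].

Let L0 : (L == 0) = false. Proof. by []. Qed.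

Lemma valid0 w : valid b L 0 w = (w == if b then [:: 0; L] else [:: 0; L; 0]).
Proof.
have L1 : 0 < L by [].
apply/idP/eqP => [|->]; last first.
  by case: b; rewrite /valid /letters /= !eqxx // /linked addr0 L1 (eq_sym 0) L0 orbT perm_refl.
case/and4P; case: w => [|x w]; first by rewrite /= L0.
rewrite [head _ _]/= [last _ _]/= => /eqP -> + s; rewrite /letters /=.
have noL v : [seq `|z|%N | z <- v & z != L] = [::] -> all (pred1 L) v.
  by elim: v => //= z v IH; case: eqP.
case: b => /= /eqP.
  rewrite perm_cons => l /perm_nilP /noL.
  case: w l s => [|y [|z w]] /= l s; first by move: l => /eqP; rewrite eq_sym L0.
    by move=> /andP[/eqP ->].
  by move=> /and3P[/eqP yL /eqP zL _]; case/and3P: s => _; rewrite yL zL /linked eqxx andbF.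
rewrite perm_cons => l /(perm_small_eq (isT : size [:: 0%N] <= 1)%N).
case: w l s => [|y w] //= l /andP[e0y]; have y0 : 0 < y by move: e0y; rewrite /linked; lia.
case: eqP => [->|_] /= ew; last by case; lia.
case: w l ew => [|z w] //= l /andP[eLz ew].
have zL : z != L by move: eLz; rewrite /linked eqxx => /andP[].
rewrite zL /= => -[z0 /noL]; have {z0} -> : z = 0 by lia.
case: w l ew => // t w l _ /allP aL; move: l; rewrite [last _ _]/=.
by move/eqP: (aL _ (mem_last t w)) => ->.
Qed.

Lemma mem_states m w : (m <= n)%N -> (w \in states m) = valid b L m w.
Proof.
elim: m w => [|m IH] w mn; first by rewrite valid0 inE.
have ML : m.+1%:Z < L by rewrite ltz_nat.
apply/flatten_mapP/idP => [[v vs /expandP [a [c [u [E -> uc]]]]]|g].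
  by apply: valid_fill uc _ => //; rewrite -E -IH // ltnW.
have [a [c [u [uc -> g']]]] := valid_parent ML g.
by exists (a ++ L :: c); [rewrite IH // ltnW | apply/expandP; exists a, c, u].
Qed.

(** A word determines the word that it comes from, by [collapse], so no word is
    listed twice. *)
Lemma uniq_states m : (m <= n)%N -> uniq (states m).
Proof.
elim: m => // m IH mn; have ML : m.+1%:Z < L by rewrite ltz_nat.
have : all (valid b L m) (states m) by apply/allP => w; rewrite mem_states // ltnW.
have {IH} := IH (ltnW mn); rewrite /=; elim: (states m) => //= w s IH /andP[ws us] /andP[gw gs].
have [_ _ pw _] := and4P gw; have Sw := valid_small gw.
rewrite cat_uniq uniq_expand // IH // andbT /=.
apply/hasPn => v /flatten_mapP[w' w's vw']; apply: contra ws => vw.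
have /and4P[_ _ pw' _] := allP gs _ w's; have Sw' := valid_small (allP gs _ w's).
by rewrite -(collapse_expand ML pw Sw vw) (collapse_expand ML pw' Sw' vw').
Qed.

Section Sum.
Variables (K : fieldType) (q : K).
Hypothesis q0 : q != 0.

Lemma sum_expand m r w : (m < n)%N -> valid b L m w ->
  \sum_(v <- expand L m.+1 w) weight q b L v * fillings q b r (holes b L v) =
  weight q b L w * fillings q b r.+1 (holes b L w).
Proof.
move=> mn gw; have ML : m.+1%:Z < L by rewrite ltz_nat.
have Sw := valid_small gw; case/and4P: gw.
case: w Sw => [|x w] Sw; first by rewrite /= L0.
move=> /eqP; rewrite [head _ _]/= => x0; rewrite {x}x0 in Sw * => l s _.
have lw : (last 0 w == L) = b by move/eqP: l => /= ->; case: b; rewrite ?eqxx // eq_sym.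
rewrite expand_cons (eq_sym 0) L0 cat0s big_map.
rewrite (sum_expand_suffix q0 (b := b) (isT : (0 < m.+1)%N) ML (fillings q b r) (a := [::])) //.
  congr (_ * _); rewrite fillingsS /step_sum lw.
  suff -> : falls m.+1 w = holes b L (0 :: w) by [].
  rewrite /holes [count_mem _ _]/= add0n.
  case: w {l s} Sw s lw => [|y w] Sw s lw; first by [].
  have := @falls_count L m.+1 isT ML y w; rewrite lw.
  move: s Sw => /andP[_ s] /andP[_ Sw] => <- //.
  by rewrite addnK.
Qed.

(** Induction on the number m of letters already inserted; m = 0 leaves only
    the initial word, of weight 1. *)
Lemma sum_states m r : (m <= n)%N ->
  \sum_(w <- states m) weight q b L w * fillings q b r (holes b L w) =
  fillings q b (m + r) (~~ b).
Proof.
elim: m r => [|m IH] r mn.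
  rewrite big_seq1 add0n.
  have -> : weight q b L (if b then [:: 0; L] else [:: 0; L; 0]) = 1.
    by rewrite /weight /sign_pairs /stat /letter_stat; case: (b);
       rewrite /= !eqxx /= ?mul0r ?mulr0 ?ltxx ?addr0 expr0z scale1r.
  rewrite mul1r; suff -> : holes b L (if b then [:: 0; L] else [:: 0; L; 0]) = ~~ b by [].
  by rewrite /holes; case: (b); rewrite /= !eqxx.
rewrite addSnnS -IH ?(ltnW mn) // [states _]/= big_flatten big_map big_seq [RHS]big_seq.
by apply: eq_bigr => w; rewrite mem_states ?(ltnW mn) // => gw; apply: sum_expand.
Qed.

Lemma sum_filled :
  \sum_(w <- states n | holes b L w == 0%N) weight q b L w = fillings q b n (~~ b).
Proof.
rewrite -[n in RHS]addn0 -sum_states // big_mkcond; apply: eq_bigr => w _.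
by rewrite /=; case: eqP; rewrite ?mulr1 ?mulr0.
Qed.
End Sum.
End States.

(** * The statistics of snakes as statistics of words *)

Lemma stat_nth b L p u s : stat b L p u s =
  \sum_(0 <= i < size u) letter_stat b L (p ++ take i u) (nth 0 u i) (drop i.+1 u ++ s).
Proof.
elim: u p => [|x u IH] p; first by rewrite big_nil.
rewrite big_nat_recl // [LHS]/= IH /= cats0 drop0; congr (_ + _).
by apply: eq_bigr => i _; rewrite cat_rcons.
Qed.

Section WordStatistics.
Variables (b : bool) (N : nat) (w : nat -> int).
Let L : int := N.+1%:Z.
Hypothesis w0 : w 0%N = 0.
Hypothesis wN : w N.+1 = if b then (-1) ^+ N * L else 0.
Hypothesis w_perm : perm_eq [seq aw w i | i <- iota 1 N] (iota 1 N).

(** The sequence tau_0, ..., tau_(N+1). *)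
Definition unfold_signs : seq int := mkseq (fun i => (-1) ^+ i.+1 * w i) N.+2.
Local Notation v := unfold_signs.
Hypothesis v_edge : sorted (linked L) v.

Let size_v : size v = N.+2. Proof. by rewrite size_mkseq. Qed.

Let nth_v i : (i < N.+2)%N -> nth 0 v i = (-1) ^+ i.+1 * w i.
Proof. by move=> iN; rewrite nth_mkseq. Qed.

Let abs_v i : (i < N.+2)%N -> `|nth 0%R v i|%N = aw w i.
Proof. by move=> iN; rewrite nth_v // abszMsign. Qed.

Let sum_v i : (i < N.+1)%N -> 0 < nth 0 v i + nth 0 v i.+1.
Proof.
by move=> iN; have /(sortedP 0)/(_ i) := v_edge; rewrite size_v ltnS => /(_ iN) /andP[].
Qed.

Let mul_v i : (i < N.+1)%N -> (0 < nth 0 v i * nth 0 v i.+1) = (w i * w i.+1 < 0).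
Proof.
move=> iN; rewrite !nth_v ?ltnS //; last exact: ltnW.
rewrite -signr_odd -[(-1) ^+ i.+2]signr_odd /= negbK; case: (odd i).
  by rewrite expr0 expr1 mul1r mulN1r mulrN oppr_gt0.
by rewrite expr0 expr1 mul1r mulN1r mulNr oppr_gt0.
Qed.

Lemma sign_pairs_unfold : sign_pairs v = cs N w.
Proof.
rewrite /sign_pairs (pairs_nth _ 0) size_v /cs !big_mkord.
by apply: eq_bigr => i _; rewrite mul_v.
Qed.

Lemma pos_aw i : (0 < i <= N)%N -> pos N w (aw w i) = i.
Proof.
move=> /andP[i0 iN]; rewrite /pos -[in aw w i](_ : nth 0%N (iota 1 N) i.-1 = i); last first.
  by rewrite nth_iota; lia.
rewrite -(nth_map 0%N 0%N) ?size_iota; last lia.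
by rewrite index_uniq ?(perm_uniq w_perm) ?iota_uniq ?size_map ?size_iota; lia.
Qed.

Lemma rises_take i : (0 < i <= N)%N -> rises (aw w i) (take i v) = pat132 N w (aw w i).
Proof.
move=> iN; rewrite /rises (pairs_nth _ 0) /pat132 pos_aw // size_take size_v.
rewrite (_ : (i < N.+2)%N); last lia.
apply: eq_big_nat => j ji; rewrite !nth_take; try lia.
by rewrite !abs_v; lia.
Qed.

Lemma falls_drop i : (0 < i <= N)%N -> falls (aw w i) (drop i.+1 v) = pat231 N w (aw w i).
Proof.
move=> iN; rewrite /falls (pairs_nth _ 0) /pat231 pos_aw // size_drop size_v.
rewrite [in RHS](_ : i.+1 = 0 + i.+1)%N // big_addn.
rewrite (_ : (N.+2 - i.+1).-1 = N.+1 - i.+1)%N; last lia.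
apply: eq_big_nat => j ji; rewrite !nth_drop !abs_v; try lia.
by rewrite andbC addnS addnC.
Qed.

Definition letter_exponent i : int :=
  let k := aw w i in let g := (pat132 N w k)%:Z + (pat231 N w k)%:Z in
  (pat231 N w k)%:Z
  + (if [&& (aw w i.-1 > aw w i)%N, (aw w i < aw w i.+1)%N,
        w i.-1 * w i < 0 & w i * w i.+1 < 0] then 2 * g - 2 + b%:Z else 0)
  + (if (((aw w i.-1 < aw w i) && (aw w i < aw w i.+1)) ||
    ((aw w i.-1 > aw w i) && (aw w i > aw w i.+1)))%N then g else 0)
  + (if ((aw w i.-1 < aw w i) && (aw w i > aw w i.+1))%N then (~~ b)%:Z else 0).

(** The sign conditions in the definition of X compare a valley with both its
    neighbours; as the larger of two linked letters is positive, they amount to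
    the positivity of tau_i. *)
Lemma letter_stat_nth i : (0 < i <= N)%N ->
  letter_stat b L (take i v) (nth 0 v i) (drop i.+1 v) = letter_exponent i.
Proof.
move=> iN; rewrite /letter_stat /letter_exponent abs_v; last lia.
have awi : aw w i \in iota 1 N.
  by rewrite -(perm_mem w_perm) map_f // mem_iota; lia.
have vL : nth 0 v i != L.
  apply/eqP => /(congr1 absz); rewrite abs_v ?mem_iota in awi *; lia.
rewrite (_ : (0 < aw w i)%N && (nth 0 v i != L)); last first.
  by rewrite vL andbT; move: awi; rewrite mem_iota => /andP[].
rewrite rises_take // falls_drop //.
have -> : last 0 (take i v) = nth 0 v i.-1.
  by rewrite -nth_last size_take size_v (_ : (i < N.+2)%N) ?nth_take //; lia.
have -> : head 0 (drop i.+1 v) = nth 0 v i.+1 by rewrite -nth0 nth_drop addn0.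
rewrite !abs_v; try lia.
have iN1 : (i < N.+1)%N by lia.
have i1N : (i.-1 < N.+1)%N by lia.
have i1E : i.-1.+1 = i by lia.
have s1 := sum_v i1N; have s2 := sum_v iN1; have m1 := mul_v i1N; have m2 := mul_v iN1.
rewrite i1E in s1 m1.
have [a0 a1 a2] : [/\ aw w i.-1 = `|nth 0%R v i.-1|%N, aw w i = `|nth 0%R v i|%N & aw w i.+1 = `|nth 0%R v i.+1|%N].
  by split; rewrite abs_v //; lia.
congr (_ + _ + _ + _); last by rewrite [X in _ || X]andbC.
have big_pos (x y : int) : 0 < x + y -> (`|y| < `|x|)%N -> 0 < x by lia.
rewrite -m1 -m2 a0 a1 a2; have [lt1|//] := boolP (`|nth 0%R v i| < `|nth 0%R v i.-1|)%N.
have [lt2|//] := boolP (`|nth 0%R v i| < `|nth 0%R v i.+1|)%N.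
rewrite addrC in s2.
by rewrite (pmulr_rgt0 _ (big_pos _ _ s1 lt1)) (pmulr_lgt0 _ (big_pos _ _ s2 lt2)) andbb.
Qed.

Lemma stat_unfold : stat b L [::] v [::] = \sum_(i <- iota 1 N) letter_exponent i.
Proof.
pose f i := letter_stat b L (take i v) (nth 0 v i) (drop i.+1 v).
have -> : stat b L [::] v [::] = \sum_(0 <= i < N.+2) f i.
  by rewrite stat_nth size_v; apply: eq_bigr => i _; rewrite cats0.
have z i : (i < N.+2)%N -> (aw w i == 0%N) || (nth 0 v i == L) -> f i = 0.
  move=> iN; rewrite /f /letter_stat abs_v // => /orP[/eqP ->|->] //.
  by rewrite andbF.
rewrite big_nat_recl // big_nat_recr //= [f 0%N]z ?/aw ?w0 // add0r.
rewrite [f N.+1]z ?addr0 //; last first.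
  rewrite nth_v // /aw wN; case: b => //; apply/orP; right.
  by rewrite mulrA -exprD !addSn addnn -signr_odd /= negbK odd_double mul1r.
rewrite -[1%N]addn0 iotaDl big_map /index_iota subn0 big_seq [RHS]big_seq.
apply: eq_bigr => i; rewrite mem_iota => iN.
by rewrite /f letter_stat_nth //; lia.
Qed.

(** The sums over the values in X, Y and Z are turned into sums over positions,
    where they are compared letter by letter. *)
Lemma exponent_unfold :
  stat b L [::] v [::] = (tot231 N w)%:Z + (if b then patQ N w else patR N w).
Proof.
have SX (C : pred nat) (f : nat -> int) :
    \sum_(j <- [seq aw w i | i <- iota 1 N & C i]) f j =
    \sum_(i <- iota 1 N) if C i then f (aw w i) else 0.
  by rewrite big_map big_filter big_mkcond.
have Ssize (s : seq nat) : (size s)%:Z = \sum_(j <- s) 1.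
  by elim: s => [|x s IH]; rewrite ?big_nil // big_cons -IH.
have -> : (tot231 N w)%:Z = \sum_(i <- iota 1 N) (pat231 N w (aw w i))%:Z.
  rewrite /tot231 /index_iota subSS subn0 -(perm_big _ w_perm) big_map.
  by rewrite (big_morph Posz PoszD (erefl 0)).
rewrite stat_unfold /letter_exponent /patQ /patR /Xset /Yset /Zset; case: b.
  rewrite !Ssize !SX -sumrB -!big_split; apply: eq_bigr => i _ /=.
  by do 3!case: ifP => _; ring.
rewrite !Ssize !SX -!big_split; apply: eq_bigr => i _ /=.
by do 3!case: ifP => _; ring.
Qed.

End WordStatistics.

(** * Snakes and words without holes *)

Section SnakeWords.
Variables (b : bool) (N : nat).
Let L : int := N.+1%:Z.
Implicit Types (s : {perm pmset N}).

Definition end_value : int := if b then (-1) ^+ N * L else 0.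
Definition snakes : {set {perm pmset N}} := if b then S0 N else S00 N.
Definition snake_word s := unfold_signs N (word end_value s).

Lemma word_ord e s (i : 'I_N) : word e s i.+1 = pmval (s (false, i)).
Proof. by rewrite /word valK. Qed.

Lemma word_end e s : word e s N.+1 = e.
Proof. by rewrite /word insubN // ltnn. Qed.

Lemma abs_pmval (x : pmset N) : `|pmval x|%N = x.2.+1.
Proof. by rewrite /pmval abszMsign. Qed.

Lemma pmval_inj : injective (@pmval N).
Proof.
move=> [c i] [d j] E; have := congr1 absz E; rewrite !abs_pmval /= => -[/val_inj ij].
by move: E; rewrite /pmval /= ij; case: c; case: d => //=; rewrite !(expr0, expr1) mul1r; lia.
Qed.

(** As s (-j) = - s (j), two positions whose images have the same absolute value
    are equal or opposite; positive positions are then equal. *)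
Lemma word_abs_perm e s : signed_perm s ->
  perm_eq [seq aw (word e s) i | i <- iota 1 N] (iota 1 N).
Proof.
move=> /forallP sg.
have -> : [seq aw (word e s) i | i <- iota 1 N] = [seq (s (false, i)).2.+1 | i <- enum 'I_N].
  rewrite -[1%N]addn0 iotaDl -map_comp -val_enum_ord -map_comp; apply: eq_map => i /=.
  by rewrite /aw word_ord abs_pmval.
have u : uniq [seq (s (false, i)).2.+1 : nat | i <- enum 'I_N].
  rewrite map_inj_uniq ?enum_uniq // => i j [/val_inj].
  case E : (s (false, i)) => [c k]; case E' : (s (false, j)) => [d l] /= kl.
  subst l.
  have [cd|cd] := eqVneq c d.
    by have /perm_inj[] : s (false, i) = s (false, j) by rewrite E E' cd.
  have := eqP (sg (false, i)); rewrite E (_ : pmopp (c, k) = s (false, j)); last first.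
    by rewrite E' /pmopp /=; congr (_, _); case: (c) (d) cd => [] [].
  by move/perm_inj.
apply: uniq_perm; rewrite ?iota_uniq // => x.
have [] := uniq_min_size u _ _ (s2 := iota 1 N).
- by move=> y /mapP[i _ ->]; rewrite mem_iota /= add1n ltnS; exact: ltn_ord.
- by rewrite size_iota size_map -cardE card_ord.
by move=> _ ->.
Qed.

Lemma word_interior e e' s i : (i <= N)%N -> word e s i = word e' s i.
Proof. by case: i => // i iN; rewrite -[i]/(val (Ordinal iN)) !word_ord. Qed.

Lemma size_snake_word s : size (snake_word s) = N.+2.
Proof. by rewrite size_mkseq. Qed.

Lemma nth_snake_word s i : (i < N.+2)%N ->
  nth 0 (snake_word s) i = (-1) ^+ i.+1 * word end_value s i.
Proof. by move=> iN; rewrite nth_mkseq. Qed.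

Lemma snake_word_last s : nth 0 (snake_word s) N.+1 = if b then L else 0.
Proof.
rewrite nth_snake_word // word_end /end_value; case: b; last by rewrite mulr0.
by rewrite mulrA -exprD !addSn addnn -signr_odd /= negbK odd_double mul1r.
Qed.

Lemma snake_wordE s : snake_word s =
  0 :: rcons [seq (-1) ^+ i.+1 * word 0 s i | i <- iota 1 N] (if b then L else 0).
Proof.
rewrite /snake_word /unfold_signs /mkseq -[N.+2]addn1 iotaD map_cat cats1.
rewrite /= mulr0 add0n; congr (_ :: rcons _ _).
  apply/eq_in_map => i; rewrite mem_iota => iN; congr (_ * _); apply: word_interior; lia.
by rewrite -(snake_word_last s) nth_snake_word.
Qed.

Lemma snakes_signed s : s \in snakes -> signed_perm s.
Proof.
by rewrite /snakes; case: b;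
  [rewrite !inE => /andP[/andP[]] | rewrite !inE => /andP[/andP[/andP[]]]].
Qed.

Lemma snake_stepE i (x y : int) : (if odd i then x > y else x < y) =
  (0 < (-1) ^+ i.+1 * x + (-1) ^+ i.+2 * y).
Proof.
rewrite -signr_odd -[(-1) ^+ i.+2]signr_odd /= negbK.
by case: (odd i); rewrite /= !(expr0, expr1) mul1r mulN1r; lia.
Qed.

(** The links inside the word are the snake inequalities.  At its ends, the link
    0 < tau_1 is the condition sigma_1 > 0; on the right, N+1 exceeds |tau_N|
    if b holds, and tau_N > 0 is the extra condition of S00 otherwise. *)
Lemma snake_word_valid s : s \in snakes -> valid b L N (snake_word s) && (holes b L (snake_word s) == 0)%N.
Proof.
move=> ss.
have [sn h1 hN] : [/\ snake s, (0 < N)%N ==> (0 < word 0 s 1) & ~~ b -> (-1) ^+ N * word 0 s N < 0].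
  by move: ss; rewrite /snakes; case: b; [rewrite !inE => /andP[] | rewrite !inE => /andP[/andP[]]].
have [sg al] := andP sn; have wp := word_abs_perm 0 sg.
have inner i : (0 < i <= N)%N -> (0 < aw (word 0 s) i <= N)%N.
  move=> iN; have : aw (word 0 s) i \in iota 1 N.
    by rewrite -(perm_mem wp) map_f // mem_iota; lia.
  by rewrite mem_iota; lia.
have innerL x : x \in [seq (-1) ^+ i.+1 * word 0 s i | i <- iota 1 N] -> x != L.
  case/mapP=> i; rewrite mem_iota => iN ->; apply/eqP => /(congr1 absz).
  by rewrite abszMsign -/(aw _ _) => E; have := inner i; rewrite E; lia.
have innerC : count_mem L [seq (-1) ^+ i.+1 * word 0 s i | i <- iota 1 N] = 0%N.
  by apply/count_memPn/negP => /innerL; rewrite eqxx.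
have innerF : [seq x <- [seq (-1) ^+ i.+1 * word 0 s i | i <- iota 1 N] | x != L] =
    [seq (-1) ^+ i.+1 * word 0 s i | i <- iota 1 N].
  by apply/all_filterP/allP.
apply/andP; split; last first.
  by rewrite snake_wordE /holes /= -cats1 count_cat innerC /=; case: b; rewrite ?eqxx.
apply/and4P; split.
- by rewrite snake_wordE.
- by rewrite snake_wordE /= last_rcons.
- apply/(sortedP 0) => i; rewrite size_snake_word ltnS => iN.
  have e0 : nth 0 (snake_word s) i = (-1) ^+ i.+1 * word 0 s i.
    by rewrite nth_snake_word ?(word_interior _ 0) // ltnW.
  have abs0 : (`|nth 0%R (snake_word s) i| <= N)%N.
    rewrite e0 abszMsign; case: (posnP i) => [->|i0]; first by [].
    by have := inner i; rewrite /aw; lia.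
  apply/andP; split; last by apply/orP; left; lia.
  have [iN'|iN'] := ltnP i N; last first.
    have {iN iN'} E : i = N by lia.
    rewrite {i}E in e0 abs0 *; rewrite snake_word_last.
    case: (b) hN => [_|/(_ isT) hN']; first lia.
    by rewrite e0 addr0 exprS mulN1r mulNr oppr_gt0.
  rewrite e0 nth_snake_word // (word_interior _ 0) //.
  have [->|i0] := posnP i.
    have N1 : (0 < N)%N by apply: leq_ltn_trans iN'.
    by move: h1; rewrite N1 implyTb [word 0 s 0]/= mulr0 add0r sqrrN expr1n mul1r.
  by have /forallP/(_ (Ordinal iN')) := al; rewrite /= i0 snake_stepE.
- rewrite snake_wordE /letters /= filter_rcons innerF.
  have pi : perm_eq [seq `|x|%N | x <- [seq (-1) ^+ i.+1 * word 0 s i | i <- iota 1 N]] (iota 1 N).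
    rewrite -map_comp (eq_map (_ : _ =1 aw (word 0 s))) // => i.
    by rewrite /= abszMsign.
  case: b; rewrite ?eqxx /= perm_cons //.
  by rewrite map_rcons /= perm_rcons perm_cons.
Qed.

Lemma snake_word_inj : {in snakes &, injective snake_word}.
Proof.
move=> s t ss tt E.
have eqp i : s (false, i) = t (false, i).
  apply: pmval_inj; rewrite -!(word_ord end_value).
  have iN : (i.+1 < N.+2)%N by have := ltn_ord i; lia.
  by have := congr1 (fun u => nth 0 u i.+1) E; rewrite !nth_snake_word // => /(mulrI _); apply; rewrite unitrX ?unitrN1.
apply/permP => -[[] i] //.
have /forallP/(_ (false, i))/eqP := snakes_signed ss; have /forallP/(_ (false, i))/eqP := snakes_signed tt.
by rewrite /pmopp /= eqp => -> ->.
Qed.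

Lemma valid_interior v : valid b L N v -> holes b L v = 0%N ->
  exists2 u, v = 0 :: rcons u (if b then L else 0) & perm_eq [seq `|x|%N | x <- u] (iota 1 N).
Proof.
move=> /and4P[h l _ p] hv.
case: v h l p hv => [|x v]; first by rewrite /= /L.
rewrite [head _ _]/= => /eqP ->; case/lastP: v => [|u e].
  by rewrite /=; case: b => // _ /perm_size.
rewrite [last _ _]/= last_rcons => /eqP -> p hv.
exists u => //.
have uL : count_mem L u = 0%N.
  by move: hv; rewrite /holes /= -cats1 count_cat /=; case: b; rewrite ?eqxx //; lia.
have uF : [seq x <- u | x != L] = u.
  apply/all_filterP/allP => y yu; apply/eqP => yL; rewrite yL in yu.
  by have /count_memPn := uL; rewrite yu.
move: p; rewrite /letters /= filter_rcons uF; case: b; rewrite ?eqxx /= perm_cons //.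
by rewrite map_rcons /= perm_rcons perm_cons.
Qed.

Section Inverse.
Variable u : seq int.
Hypothesis pu : perm_eq [seq `|x|%N | x <- u] (iota 1 N).

Let size_u : size u = N.
Proof. by have := perm_size pu; rewrite size_map size_iota. Qed.

Let abs_u (j : 'I_N) : (0 < `|nth 0%R u j| <= N)%N.
Proof.
have : `|nth 0%R u j|%N \in iota 1 N.
  by rewrite -(perm_mem pu) map_f // mem_nth // size_u.
by rewrite mem_iota; lia.
Qed.

(** The signed permutation whose word is u: it sends j+1 to sigma_(j+1) =
    (-1)^j tau_(j+1), encoded by its sign and by its absolute value minus 1.
    The default value x.2 is never reached. *)
Definition letter_image (x : pmset N) : pmset N :=
  (x.1 (+) ((-1) ^+ x.2 * nth 0 u x.2 < 0), insubd x.2 (`|nth 0%R u x.2|.-1)%N).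

Let val_image x : val (letter_image x).2 = (`|nth 0%R u x.2|.-1)%N.
Proof. by rewrite val_insubd ifT //; have := abs_u x.2; lia. Qed.

Lemma letter_image_inj : injective letter_image.
Proof.
move=> [c i] [d j] E; have := congr1 (fun x : pmset N => val x.2) E.
rewrite !val_image /= => Ev.
have /(congr1 (index^~ [seq `|x|%N | x <- u])) : `|nth 0%R u i|%N = `|nth 0%R u j|%N.
  have Ev1 : (`|nth 0%R u i|%N.-1 = `|nth 0%R u j|%N.-1)%N by exact: Ev.
  by have := abs_u i; have := abs_u j; lia.
rewrite -!(nth_map 0 0%N) ?size_u // !index_uniq ?size_map ?size_u ?(perm_uniq pu) ?iota_uniq //.
move=> /val_inj ij; subst j; congr (_, _).
by have /(congr1 fst)/= := E => /addIb.
Qed.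

Definition inverse_perm : {perm pmset N} := perm letter_image_inj.

Lemma word_inverse e (j : 'I_N) : word e inverse_perm j.+1 = (-1) ^+ j * nth 0 u j.
Proof.
rewrite word_ord permE /pmval val_image prednK; last by have /andP[] := abs_u j.
rewrite /= -(abszMsign j); set z : int := (-1) ^+ j * nth 0 u j.
by case: (ltrP z 0) => z0; rewrite /= !(expr0, expr1); lia.
Qed.

Lemma snake_word_inverse : snake_word inverse_perm = 0 :: rcons u (if b then L else 0).
Proof.
rewrite snake_wordE; congr (_ :: rcons _ _).
apply: (@eq_from_nth _ 0); rewrite size_map size_iota ?size_u // => j jN.
rewrite (nth_map 0%N) ?size_iota // nth_iota // add1n.
rewrite -[j in word _ _ j.+1]/(val (Ordinal jN)) word_inverse /=.
by rewrite mulrA -exprD !addSn addnn -signr_odd /= negbK odd_double mul1r.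
Qed.

Lemma inverse_signed : signed_perm inverse_perm.
Proof. by apply/forallP => -[c j]; rewrite !permE /letter_image /pmopp /= addNb. Qed.

Lemma inverse_snake : sorted (linked L) (0 :: rcons u (if b then L else 0)) ->
  inverse_perm \in snakes.
Proof.
rewrite -snake_word_inverse => /(sortedP 0); rewrite size_snake_word => ev.
have {}ev i : (i < N.+1)%N -> 0 < nth 0 (snake_word inverse_perm) i + nth 0 (snake_word inverse_perm) i.+1.
  by move=> iN; have /andP[] := ev i iN.
have s0 : inverse_perm \in S0 N.
  rewrite inE /snake inverse_signed /=; apply/andP; split.
    apply/forallP => i; apply/implyP => i0; rewrite snake_stepE.
    have := ev i; rewrite !nth_snake_word ?(word_interior _ 0) //; try by have := ltn_ord i; lia.
    by apply; have := ltn_ord i; lia.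
  apply/implyP => N1; have := ev 0%N isT; rewrite !nth_snake_word // (word_interior _ 0) //.
  by rewrite [word _ _ 0]/= mulr0 add0r sqrrN expr1n mul1r (word_interior _ 0).
rewrite /snakes; case bE : b => //; rewrite inE s0 /=.
have := ev N; rewrite snake_word_last bE addr0 nth_snake_word // (word_interior _ 0) //.
by rewrite exprS mulN1r mulNr oppr_gt0; apply.
Qed.
End Inverse.

Lemma snake_word_surj v : valid b L N v -> holes b L v = 0%N ->
  exists2 s, s \in snakes & snake_word s = v.
Proof.
move=> g hv; have [u vE pu] := valid_interior g hv.
exists (inverse_perm pu); last by rewrite snake_word_inverse.
by apply: inverse_snake; rewrite -vE; case/and4P: g.
Qed.

Lemma perm_snake_words :
  perm_eq [seq snake_word s | s <- enum snakes]
    [seq w <- states b N N | holes b L w == 0%N].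
Proof.
apply: uniq_perm.
- rewrite map_inj_in_uniq ?enum_uniq // => s t; rewrite !mem_enum.
  exact: snake_word_inj.
- by rewrite filter_uniq // uniq_states.
move=> w; rewrite mem_filter mem_states //; apply/mapP/andP => [[s]|[/eqP hw gw]].
  by rewrite mem_enum => /snake_word_valid/andP[g h] ->.
by have [s ss <-] := snake_word_surj gw hw; exists s; rewrite ?mem_enum.
Qed.

Lemma sum_snakes (K : fieldType) (q : K) : q != 0 ->
  \sum_(s in snakes)
    q ^ ((tot231 N (word end_value s))%:Z
         + (if b then patQ N else patR N) (word end_value s))
    *: 'X^(cs N (word end_value s)) = fillings q b N (~~ b).
Proof.
move=> q0; rewrite -(sum_filled _ _ q0) -[RHS]big_filter.
rewrite -[RHS](perm_big _ perm_snake_words) /=.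
rewrite big_map [RHS]big_enum /=; apply: eq_bigr => s ss.
have /andP[/and4P[_ _ ev _] _] := snake_word_valid ss.
have sg := snakes_signed ss.
rewrite /weight (@exponent_unfold _ _ (word end_value s)) ?(@sign_pairs_unfold _ (word end_value s)) //.
- by case: b.
- exact: word_end.
- exact: word_abs_perm.
Qed.

End SnakeWords.

(** * The polynomials as sums over snakes *)

Section SnakePolynomials.
Variables (K : fieldType) (q : K).
Hypotheses (q0 : q != 0) (q1 : q != 1).

Lemma Qpoly_snakes n : Qpoly q n =
  \sum_(s in S0 n)
    q ^ ((tot231 n (word0 s))%:Z + patQ n (word0 s)) *: 'X^(cs n (word0 s)).
Proof.
have := Qpoly_fillings q1 n 0; rewrite /qfact big_ord0 scale1r => E.
rewrite -[LHS]/(iter 0 (Dq q) (Qpoly q n)) E.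
exact/esym/(@sum_snakes true n K q q0).
Qed.

Lemma Rpoly_snakes n : Rpoly q n =
  \sum_(s in S00 n.+1)
    q ^ ((tot231 n.+1 (word00 s))%:Z + patR n.+1 (word00 s) - n%:Z - 1)
      *: 'X^(cs n.+1 (word00 s)).
Proof.
have qn : q ^+ n.+1 != 0 by rewrite expf_neq0.
apply: (scalerI qn); have := Rpoly_fillings q1 n 0.
rewrite /qfact big_ord0 scale1r => E.
rewrite -[Rpoly q n]/(iter 0 (Dq q) (Rpoly q n)) E.
rewrite -[LHS](@sum_snakes false n.+1 K q q0) scaler_sumr; apply: eq_bigr => s _.
rewrite scalerA; congr (_ *: _); rewrite exprnP -expfzDr //; congr (_ ^ _).
by rewrite /word00 /end_value (_ : n.+1%:Z = n%:Z + 1) -?PoszD ?addn1 //; ring.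
Qed.

End SnakePolynomials.

Theorem theorem1p8 (n : nat) :
  Qpoly qv n =
    \sum_(s in S0 n)
      qv ^ ((tot231 n (word0 s))%:Z + patQ n (word0 s)) *: 'X^(cs n (word0 s))
  /\
  Rpoly qv n =
    \sum_(s in S00 n.+1)
      qv ^ ((tot231 n.+1 (word00 s))%:Z + patR n.+1 (word00 s) - n%:Z - 1)
        *: 'X^(cs n.+1 (word00 s)).
Proof.
split; first exact: (Qpoly_snakes qv_neq0 qv_neq1).
exact: (Rpoly_snakes qv_neq0 qv_neq1).
Qed.
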